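(* Let $D>1$, $C_0,C_1,C_2\ge1$ and $p>D$. There exists a constant $c>0$, depending only on $p,D,C_0,C_1,C_2$, such that, for every connected locally finite weighted graph $(V,\omega,\mu)$ satisfying conditions (G1)–(G3) listed in the context with the constants $D,C_0,C_1,C_2$, every nonempty finite subset $\Omega\subset V$ and every $w:\Omega\to\mathbb{R}$: if the Dirichlet problem $$-\Delta_p^\omega u(x)=w(x)|u(x)|^{p-2}u(x)\quad (x\in\Omega),\qquad u(x)=0\quad (x\in V\setminus\Omega)$$ admits a nontrivial solution $u\in X_V(\Omega)$ (i.e. $u\not\equiv0$), then $$\|w_+\|_{\ell^1(\Omega,\mu)}\ge c\, r_\Omega^{-(p-D)}.$$
   Context: A weighted graph is a triple $(V,\omega,\mu)$ where $V$ is a countably infinite set, $\mu:V\to(0,\infty)$, and $\omega:V\times V\to[0,\infty)$ satisfies $\omega_{xy}=\omega_{yx}$ and $\omega_{xx}=0$. Write $x\sim y$ if $\omega_{xy}>0$, and $\deg(x)=\#\{y\in V:y\sim x\}$. The graph is locally finite if $\deg(x)<\infty$ for all $x$, and connected if any two vertices are joined by a finite path $x=x_0\sim x_1\sim\cdots\sim x_m=y$ (of length $m$). The graph distance $d(x,y)$ is the minimal length of a path from $x$ to $y$; $B(x,R)=\{y\in V:d(x,y)\le R\}$ for real $R\ge0$; $\mu(A)=\sum_{x\in A}\mu(x)$ for finite $A\subset V$. Conditions: (G1) $C_0^{-1}\le\mu(x)\le C_0$ for all $x\in V$; $C_0^{-1}\le\omega_{xy}\le C_0$ whenever $x\sim y$;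 $\deg(x)\le C_0$ for all $x\in V$. (G2) $C_1^{-1}R^D\le\mu(B(x,R))\le C_1R^D$ for all $x\in V$ and all real $R\ge1$. (G3) For every $x_0\in V$, every $R\ge1$ and every $A\subset B(x_0,R)$, $$\min\{\mu(A),\mu(B(x_0,R)\setminus A)\}\le C_2R\sum_{\substack{x\in A,\ y\in B(x_0,R)\setminus A\\ y\sim x}}\omega_{xy}.$$ $X_V(\Omega)=\{u:V\to\mathbb{R}:u=0\text{ in }V\setminus\Omega\}$. The discrete $p$-Laplacian is $\Delta_p^\omega u(x)=\frac{1}{\mu(x)}\sum_{y\sim x}\omega_{xy}|u(y)-u(x)|^{p-2}(u(y)-u(x))$, with the convention $|t|^{p-2}t=0$ at $t=0$. The inner radius is $r_\Omega=\sup_{x\in\Omega}d(x,V\setminus\Omega)$, where $d(x,V\setminus\Omega)=\inf_{y\in V\setminus\Omega}d(x,y)$. $w_+(x)=\max\{w(x),0\}$ and $\|f\|_{\ell^1(\Omega,\mu)}=\sum_{x\in\Omega}\mu(x)|f(x)|$. *)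

(* Defs.v *)
From mathcomp Require Import all_boot all_order all_algebra finmap.
From mathcomp Require Import all_classical all_reals all_analysis.

Set Implicit Arguments.
Unset Strict Implicit.
Unset Printing Implicit Defensive.

Import Order.TTheory GRing.Theory Num.Theory.
Local Open Scope classical_set_scope.
Local Open Scope ring_scope.

Record wgraph (R : realType) := WGraph {
  vertex :> choiceType;
  vweight : vertex -> R;
  eweight : vertex -> vertex -> R;
  vertex_countably_infinite : ([set: vertex] #= [set: nat])%card;
  vweight_gt0 : forall x, 0 < vweight x;
  eweight_ge0 : forall x y, 0 <= eweight x y;
  eweight_sym : forall x y, eweight x y = eweight y x;
  eweight_diag : forall x, eweight x x = 0 }.

Section WeightedGraph.
Context {R : realType} (G : wgraph R).

Definition adj : rel G := fun x y => 0 < eweight x y.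

Definition neighbours (x : G) : set G := [set y | adj x y].

Definition locally_finite := forall x : G, finite_set (neighbours x).

(* [fset_set] sends infinite sets to the empty one, so this is the degree
   only at vertices with finitely many neighbours *)
Definition degree (x : G) : nat := #|` fset_set (neighbours x)|%fset.

Definition is_path_of_length (x y : G) (m : nat) :=
  exists s : seq G, [/\ path adj x s, last x s = y & size s = m].

Definition connected_graph :=
  forall x y : G, exists m, is_path_of_length x y m.

(* +oo if no path joins [x] to [y] *)
Definition gdist (x y : G) : \bar R :=
  ereal_inf [set (m%:R)%:E | m in is_path_of_length x y].

Definition gball (x : G) (r : R) : set G := [set y | (gdist x y <= r%:E)%E].

Definition gdist_set (x : G) (A : set G) : \bar R :=
  ereal_inf [set gdist x y | y in A].

Definition inner_radius (Omega : set G) : \bar R :=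
  ereal_sup [set gdist_set x (~` Omega) | x in Omega].

(* these finitely supported sums default to 0 on infinite supports; they are
   only used on finite sets, balls being finite in a locally finite graph *)
Definition vmeasure (A : set G) : R := \sum_(x \in A) vweight x.

Definition cut_weight (A B : set G) : R :=
  \sum_(x \in A) \sum_(y \in [set y | B y /\ adj x y]) eweight x y.

Definition bounded_geometry (C0 : R) :=
  [/\ forall x : G, C0^-1 <= vweight x <= C0,
      forall x y : G, adj x y -> C0^-1 <= eweight x y <= C0
    & forall x : G, (degree x)%:R <= C0].

Definition ball_growth (D C1 : R) :=
  forall (x : G) (r : R), 1 <= r ->
    C1^-1 * r `^ D <= vmeasure (gball x r) <= C1 * r `^ D.

Definition isoperimetric (C2 : R) :=
  forall (x0 : G) (r : R) (A : set G), 1 <= r -> A `<=` gball x0 r ->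
    Num.min (vmeasure A) (vmeasure (gball x0 r `\` A))
      <= C2 * r * cut_weight A (gball x0 r `\` A).

(* |t|^(p-2) t; it is 0 at t = 0 for every p *)
Definition signed_pow (p t : R) : R := `|t| `^ (p - 2) * t.

Definition pLaplacian (p : R) (u : G -> R) (x : G) : R :=
  (vweight x)^-1 *
  \sum_(y \in neighbours x) eweight x y * signed_pow p (u y - u x).

Definition vanishes_outside (Omega : {fset G}) (u : G -> R) :=
  forall x, x \notin Omega -> u x = 0.

Definition dirichlet_solution (p : R) (Omega : {fset G}) (w : Omega -> R)
    (u : G -> R) :=
  vanishes_outside Omega u /\
  forall x : Omega, - pLaplacian p u (val x) = w x * signed_pow p (u (val x)).

Definition l1norm (Omega : {fset G}) (f : Omega -> R) : R :=
  \sum_(x : Omega) vweight (val x) * `|f x|.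

End WeightedGraph.

Arguments locally_finite {R} G.
Arguments connected_graph {R} G.
Arguments bounded_geometry {R} G C0.
Arguments ball_growth {R} G D C1.
Arguments isoperimetric {R} G C2.

(* Main.v *)
Require Import Defs.
From mathcomp Require Import all_boot all_order all_algebra finmap.
From mathcomp Require Import all_classical all_reals all_analysis.
From mathcomp Require Import measurable_realfun ring lra.

(** Testing the equation against [u] and summing by parts gives
    [E(u) = 2 sum mu w |u|^p <= 2 M^p ||w_+||_1], where
    [E(u) = sum_(a, b) omega_ab |u a - u b|^p] runs over ordered pairs and
    [M = |u x|] is the maximum of [|u|].  Some vertex [y] outside the domain
    lies within [r], the inner radius, of [x], and [u y = 0].  The theorem is
    therefore the Morrey inequality
    [|u x - u y|^p <= K r^(p - D) E(u)] (lemma [morrey]), applied to this pair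
    and divided by [M^p].

    The Morrey inequality is proved on level sets.  Let [A = {u >= t}] with
    [u y < t <= u x].  The set [A] fills the ball of radius almost [0] about
    [x] and is absent from the one about [y], while for [2^n >= d(x, y)] the
    balls of radius about [2^n] overlap substantially.  Following the dyadic
    balls about [x] and about [y], the majority has to change sides somewhere:
    at some scale [2^k] with [k <= n + 1], both [A] and its complement occupy
    at least [theta 2^(kD)] of a ball ([balanced_scale]).  There the
    isoperimetric inequality gives
    [1 <= kappa 2^(k(1 - D)) cut(A)] ([cut_at_balanced_scale]).  Summing over
    all balls removes the dependence of the scale on [t], and integrating over
    [t] ([layer_cake]) gives ([level_increment])
    [u x - u y <= kappa sum_k 2^(k(1 - D)) S_k], where [S_k] is the sum of
    [omega_ab |u a - u b|] over the pairs in the two balls of radius [2^k].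

    It remains to pass to p-th powers.  In place of the Hoelder inequality, the
    elementary bound [s <= m + m^(1 - p) s^p] is used with a level [m = m_k]
    chosen for each scale.  After normalising [u x - u y = 1], the levels can be
    taken so that the terms in [m_k] add up to at most one half, while the other
    terms form a geometric sum dominated by its last term
    [2^(n(p - D)) E(u)] ([dyadic_levels]); this is where [p > D] enters. *)

Set Implicit Arguments.
Unset Strict Implicit.
Unset Printing Implicit Defensive.

Import Order.TTheory GRing.Theory Num.Theory.
Local Open Scope classical_set_scope.
Local Open Scope ring_scope.

(** * Level sets and dyadic sums *)

(** The left side is the integral of [1] over [t] in the interval from [a] to
    [b], and each indicator integrates to at most the length of its own
    interval.  With [l i] and [r i] the values of a function at the two ends of
    an edge, this is the coarea inequality. *)
Lemma layer_cake (R : realType) (I : Type) (s : seq I) (g l r : I -> R)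
    (a b : R) :
  (forall i, 0 <= g i) -> a <= b ->
  (forall t, a < t <= b -> 1 <= \sum_(i <- s) g i * (l i < t <= r i)%R%:R) ->
  b - a <= \sum_(i <- s) g i * `|r i - l i|.
Proof.
move=> g0 ab hcov; rewrite -lee_fin.
pose mu := @lebesgue_measure R.
have vol (c d : R) : mu `]c, d]%classic = if c < d then (d - c)%:E else 0%E.
  by apply: etrans (lebesgue_measure_itv _) _; rewrite /= lte_fin EFinB.
have mitv i : measurable (`]l i, r i]%classic : set (measurableTypeR R)).
  exact: measurable_itv.
have -> : (b - a)%:E = (\int[mu]_(t in `]a, b]) 1)%E.
  rewrite integral_cst ?mul1e; last exact: measurable_itv.
  rewrite [RHS]vol; case: ltP => [//|ba].
  by congr (_%:E); apply/eqP; rewrite subr_eq0 eq_le ab ba.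
apply: (@le_trans _ _ (\int[mu]_(t in `]a, b])
    (\sum_(i <- s) (g i)%:E * (\1_`]l i, r i] t)%:E))%E).
  apply: ge0_le_integral => //=.
  - apply: emeasurable_sum => i.
    apply: measurable_funeM; apply/measurable_EFinP.
    exact: measurable_indic.
  - move=> t; rewrite in_itv/= => /hcov; rewrite -lee_fin => /le_trans; apply.
    rewrite -sumEFin; apply: lee_sum => i _.
    by rewrite -EFinM lee_fin indicE mem_setE in_itv.
rewrite ge0_integral_sum//=; last 2 first.
- move=> i; apply: measurable_funeM; apply/measurable_EFinP.
  exact: measurable_indic.
- by move=> i t _; apply: mule_ge0; rewrite lee_fin.
rewrite -sumEFin; apply: lee_sum => i _.
rewrite ge0_integralZl_EFin//; last first.
  exact/measurable_EFinP/measurable_indic.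
rewrite EFinM; apply: lee_wpmul2l; first by rewrite lee_fin.
rewrite integral_indic//; apply: (@le_trans _ _ (mu `]l i, r i]%classic)).
  by apply: le_measure; rewrite ?inE//; exact: measurableI.
rewrite [leLHS]vol; case: ltP => _; last by rewrite lee_fin.
by rewrite lee_fin ler_norm.
Qed.

(** Below the level [m] the first term suffices, above it the second does.
    Applied edge by edge, this replaces the Hoelder inequality. *)
Lemma le_level_add_powR (R : realType) (p m x : R) :
  1 <= p -> 0 < m -> 0 <= x -> x <= m + m `^ (1 - p) * x `^ p.
Proof.
move=> p1 m0 x0; have [xm|mx] := leP x m.
  by rewrite (le_trans xm)// lerDl mulr_ge0// powR_ge0.
have xgt0 : 0 < x by exact: lt_trans mx.
rewrite -[leLHS]add0r lerD ?(ltW m0)//.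
have -> : x `^ p = x `^ (p - 1) * x.
  by rewrite mulrC mulr_powRB1//; exact: lt_le_trans p1.
rewrite mulrA ler_peMl// -(opprB p 1) powRN mulrC ler_pdivlMr ?powR_gt0// mul1r.
by rewrite ge0_ler_powR ?subr_ge0 ?nnegrE ?(ltW m0) ?(ltW mx).
Qed.

Lemma sum_expr_le (R : realType) (b : R) (n : nat) : 1 < b ->
  \sum_(k < n.+1) b ^+ k <= b ^+ n * (b / (b - 1)).
Proof.
move=> b1; have b10 : 0 < b - 1 by rewrite subr_gt0.
rewrite mulrA -exprSr ler_pdivlMr// mulrC -subrX1 lerBlDr lerDl.
exact: ler01.
Qed.

(** With [b = 2^s] and [s = (p - D) / (2 (p - 1))], the levels
    [m_k = d 2^(-k) b^(k - n)] make both sums geometric, of ratios [b] and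
    [a = b^(p - 1) = 2^((p - D) / 2)], hence dominated by their last term.  The
    exponent [s] is half of the largest one for which the second sum would not
    decrease in [k]. *)
Lemma dyadic_levels (R : realType) (p D C : R) : 1 < D -> D < p -> 0 < C ->
  exists K : R, 0 < K /\ forall n, exists m : nat -> R,
    [/\ forall k, 0 < m k,
        C * \sum_(k < n.+1) 2 ^+ k * m k <= 2^-1 &
        \sum_(k < n.+1) (2 ^+ k) `^ (1 - D) * m k `^ (1 - p)
          <= K * (2 ^+ n) `^ (p - D)].
Proof.
move=> D1 Dp C0.
have p1 : 0 < p - 1 by lra.
pose s := (p - D) / (2 * (p - 1)); pose a : R := 2 `^ ((p - D) / 2).
pose b : R := 2 `^ s.
have s0 : 0 < s by rewrite /s divr_gt0 ?mulr_gt0//; lra.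
have pow_gt1 (e : R) : 0 < e -> 1 < (2 : R) `^ e.
  move=> e0; have := @gt0_ltr_powR R e e0 1 2.
  by rewrite powR1 !nnegrE ler01 ler0n ltr1n; apply.
have a1 : 1 < a by apply: pow_gt1; lra.
have b1 : 1 < b by exact: pow_gt1.
have ba : b `^ (p - 1) = a.
  by rewrite /a /b -powRrM; congr (_ `^ _); rewrite /s; field; lra.
have a0 : 0 < a by lra.
have b0 : 0 < b by lra.
pose d := (2 * C * (b / (b - 1)))^-1.
have d0 : 0 < d by rewrite invr_gt0 mulr_gt0 ?divr_gt0 ?mulr_gt0//; lra.
have dE : C * (d * (b / (b - 1))) = 2^-1 by rewrite /d; field; lra.
have powexp (x e : R) k : 0 <= x -> (x ^+ k) `^ e = (x `^ e) ^+ k.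
  move=> x0; rewrite -(powR_mulrn k x0) -(powR_mulrn k (powR_ge0 x e)).
  by rewrite -!powRrM mulrC.
have invpow (x : R) : 0 <= x -> (x^-1) `^ (1 - p) = x `^ (p - 1).
  by move=> x0; rewrite -(powR_inv1 x0) -powRrM mulN1r opprB.
have aa k : (2 ^+ k) `^ (p - D) = a ^+ k * a ^+ k.
  rewrite powexp// -exprMn /a -powRD ?pnatr_eq0 ?implybT//.
  by congr ((_ `^ _) ^+ _); field.
clearbody d b a.
exists (d `^ (1 - p) * (a / (a - 1))); split.
  by rewrite mulr_gt0 ?powR_gt0 ?divr_gt0//; lra.
move=> n; exists (fun k => d * (2 ^- k * (b ^+ k * b ^- n))); split.
- by move=> k; do ![apply: mulr_gt0 => //]; rewrite ?invr_gt0 exprn_gt0 // ltr0n.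
- rewrite (eq_bigr (fun k : 'I_n.+1 => d * b ^- n * b ^+ k)); last first.
    move=> k _; rewrite mulrCA mulVKf ?expf_neq0 ?pnatr_eq0// -mulrA.
    by congr (_ * _); exact: mulrC.
  rewrite -mulr_sumr; have := sum_expr_le n b1.
  set S := \sum_(k < _) _ => hS.
  have -> : 2^-1 = C * (d * b ^- n * (b ^+ n * (b / (b - 1)))).
    by rewrite -dE; field; rewrite expf_neq0//; lra.
  by rewrite !ler_pM2l// mulr_gt0 ?invr_gt0 ?exprn_gt0.
- rewrite aa.
  rewrite (eq_bigr (fun k : 'I_n.+1 => d `^ (1 - p) * a ^+ n * a ^+ k));
    last first.
    move=> k _.
    have -> : (d * (2 ^- k * (b ^+ k * b ^- n))) `^ (1 - p) =
        d `^ (1 - p) * ((2 ^+ k) `^ (p - 1) * (a ^- k * a ^+ n)).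
      have X0 : 0 <= (2 : R) ^+ k by rewrite exprn_ge0.
      have Xb j : 0 <= b ^+ j by rewrite exprn_ge0// ltW.
      rewrite powRM ?(ltW d0) ?mulr_ge0 ?invr_ge0//.
      rewrite powRM ?mulr_ge0 ?invr_ge0// powRM ?invr_ge0//.
      rewrite !invpow// -(opprB p 1) !(powexp b) ?(ltW b0)// !powRN ba.
      by rewrite exprVn.
    have -> : (2 ^+ k : R) `^ (p - 1) = (2 ^+ k) `^ (D - 1) * (a ^+ k * a ^+ k).
      rewrite -aa -powRD ?expf_eq0 ?pnatr_eq0 ?andbF ?implybT//.
      by congr (_ `^ _); ring.
    rewrite -(opprB D 1) powRN.
    have Q0 : (2 ^+ k : R) `^ (D - 1) != 0.
      by rewrite powR_eq0 expf_eq0 pnatr_eq0 andbF.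
    have A0 : a ^+ k != 0 by rewrite expf_neq0// gt_eqF.
    by field; rewrite A0 Q0.
  rewrite -mulr_sumr; have := sum_expr_le n a1.
  set S := \sum_(k < _) _ => hS.
  rewrite -[leRHS](_ : d `^ (1 - p) * a ^+ n * (a ^+ n * (a / (a - 1))) = _).
    by rewrite ler_pM2l// mulr_gt0 ?powR_gt0 ?exprn_gt0.
  ring.
Qed.

(** * Balls, volumes and cuts *)

Section Balls.
Context {R : realType} {G : wgraph R}.
Implicit Types (x y z : G) (r : R) (A B P Q : set G) (W : {fset G}).

Lemma gdist_path_le x y z m : is_path_of_length x y m ->
  (gdist x z <= m%:R%:E + gdist y z)%E.
Proof.
move=> [s [ps ls ss]]; rewrite -leeBlDl//; apply: le_ereal_inf_tmp.
move=> _ [j [s' [ps' ls' ss']] <-]; rewrite leeBlDl// -EFinD -natrD.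
apply: ereal_inf_lbound; exists (m + j)%N => //.
by exists (s ++ s'); rewrite cat_path last_cat size_cat ls ps ss ss'.
Qed.

Lemma gdist_xx_le0 x : (gdist x x <= 0)%E.
Proof. by apply: ereal_inf_lbound; exists 0%N => //; exists [::]. Qed.

Lemma gball_center x r : 0 <= r -> gball x r x.
Proof. by move=> r0; apply: le_trans (gdist_xx_le0 x) _; rewrite lee_fin. Qed.

Lemma gball_subset x y r m : is_path_of_length x y m -> m%:R <= r ->
  gball y r `<=` gball x (r + r).
Proof.
move=> pxy mr z yz; apply: (le_trans (gdist_path_le z pxy)).
by rewrite EFinD; apply: leeD; rewrite ?lee_fin.
Qed.

Lemma vmeasure_ge0 A : 0 <= vmeasure A.
Proof. by apply: fsumr_ge0 => x _; exact/ltW/vweight_gt0. Qed.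

Lemma vmeasureID B A : finite_set B ->
  vmeasure B = vmeasure (B `&` A) + vmeasure (B `\` A).
Proof. by move=> finB; rewrite setDE; exact: fsbigID. Qed.

Lemma vmeasureS A B : finite_set B -> A `<=` B -> vmeasure A <= vmeasure B.
Proof.
move=> finB AB; rewrite (vmeasureID A finB) setIidr//.
by rewrite lerDl vmeasure_ge0.
Qed.

Lemma vmeasure1 x : vmeasure [set x] = vweight x.
Proof. exact: fsbig_set1. Qed.

(** Finite sums over infinite supports are [0] by convention, so the lower
    volume bound already excludes infinite balls. *)
Lemma finite_gball D C1 x r : 1 <= C1 -> ball_growth G D C1 -> 1 <= r ->
  finite_set (gball x r).
Proof.
move=> C11 growth r1; apply: contrapT => infB.
have /andP[+ _] := growth x r r1.
rewrite /vmeasure no_finite_support ?big_nil.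
  by rewrite leNgt mulr_gt0 ?invr_gt0 ?powR_gt0//; lra.
apply: contra_not infB; apply: sub_finite_set => y yB; split => //.
by apply/eqP; rewrite gt_eqF ?vweight_gt0.
Qed.

Lemma fsum_fset (F : G -> R) A W : A `<=` [set` W] ->
  \sum_(x \in A) F x = \sum_(x <- W) F x * (x \in A)%:R.
Proof.
move=> AW; rewrite -[in LHS](setIidr AW) fsbig_mkcondr -fsbig_seq//=.
by apply: eq_bigr => x _; case: ifP => _; rewrite ?mulr1 ?mulr0.
Qed.

(** Over a common finite set of vertices, cuts become double sums with
    indicator coefficients, which can be added and integrated in the level. *)
Lemma cut_weight_fset P Q W : P `<=` [set` W] -> Q `<=` [set` W] ->
  cut_weight P Q = \sum_(a <- W) \sum_(b <- W)
    eweight a b * ((a \in P) && (b \in Q))%:R.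
Proof.
move=> PW QW; rewrite /cut_weight (fsum_fset _ PW).
apply: eq_bigr => a _; rewrite (@fsum_fset _ _ W); last first.
  by move=> y [/QW].
rewrite mulr_suml; apply: eq_bigr => b _.
have [abgt0|] := boolP (adj a b); last first.
  rewrite /adj -leNgt => ab0.
  have -> : eweight a b = 0 by apply/eqP; rewrite eq_le ab0 eweight_ge0.
  by rewrite !mul0r.
rewrite -mulrA -natrM mulnb; congr (_ * _%:R); rewrite andbC; congr (_ && _).
by apply/idP/idP; rewrite !inE; [case|].
Qed.

End Balls.

(** * The p-energy and its Euler-Lagrange equation *)

(** The sum is over ordered pairs, so every edge counts twice; [W] is a finite
    window that contains all the edges of interest. *)
Definition energy (R : realType) (G : wgraph R) (p : R) (W : {fset G})
    (u : G -> R) : R :=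
  \sum_(a <- W) \sum_(b <- W) eweight a b * `|u a - u b| `^ p.

Section Energy.
Context {R : realType} {G : wgraph R}.
Implicit Types (x y z : G) (A B : set G) (W : {fset G}) (u : G -> R).

Lemma energy_ge0 (p : R) W u : 0 <= energy p W u.
Proof.
by rewrite sumr_ge0// => a _; rewrite sumr_ge0// => b _;
  rewrite mulr_ge0 ?eweight_ge0 ?powR_ge0.
Qed.

Lemma energy_scale (p c : R) W u :
  energy p W (fun a => c * u a) = `|c| `^ p * energy p W u.
Proof.
rewrite /energy mulr_sumr; apply: eq_bigr => a _.
rewrite mulr_sumr; apply: eq_bigr => b _.
by rewrite -mulrBr normrM powRM// mulrCA.
Qed.

Lemma signed_powN (p t : R) : signed_pow p (- t) = - signed_pow p t.
Proof. by rewrite /signed_pow normrN mulrN. Qed.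

Lemma signed_powM (p t : R) : 0 < p -> signed_pow p t * t = `|t| `^ p.
Proof.
move=> p0; rewrite /signed_pow; have [->|t0] := eqVneq t 0.
  by rewrite mulr0 normr0 powR0// gt_eqF.
rewrite [in RHS](_ : p = p - 2 + 2%:R); last by lra.
rewrite [RHS]powRD ?normr_eq0 ?t0 ?implybT// powR_mulrn// -mulrA.
by rewrite real_normK ?num_real// expr2.
Qed.

(** Exchanging the two ends of an edge changes the sign of its flux
    [signed_pow p (u a - u b)], so half of the right-hand side can be rewritten
    with [- u b] in place of [u a]. *)
Lemma energy_by_parts (p : R) W u : 0 < p ->
  energy p W u = 2 * \sum_(a <- W) u a *
    (\sum_(b <- W) eweight a b * signed_pow p (u a - u b)).
Proof.
move=> p0; set S := \sum_(a <- W) _.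
have ES : S = \sum_(a <- W) \sum_(b <- W)
    eweight a b * signed_pow p (u a - u b) * u a.
  by apply: eq_bigr => a _; rewrite mulrC mulr_suml.
have SS : S = \sum_(a <- W) \sum_(b <- W)
    eweight a b * signed_pow p (u a - u b) * - u b.
  rewrite ES exchange_big/=; apply: eq_bigr => a _; apply: eq_bigr => b _.
  by rewrite eweight_sym -opprB signed_powN mulrN mulNr mulrN.
rewrite mulr2n mulrDl mul1r {1}ES SS -big_split/=; apply: eq_bigr => a _.
rewrite -big_split/=; apply: eq_bigr => b _.
by rewrite -mulrDr -mulrA signed_powM.
Qed.

(** The equation is only known inside the domain, but outside of it the test
    function [u] vanishes; the hypotheses on [W] keep every edge that meets the
    domain inside the window. *)
Lemma energy_solution (p : R) (Omega W : {fset G}) (w : Omega -> R) u :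
  0 < p -> (forall x, x \in Omega -> x \in W) ->
  (forall x y, x \in Omega -> adj x y -> y \in W) ->
  dirichlet_solution p w u ->
  energy p W u =
    2 * \sum_(x : Omega) vweight (val x) * w x * `|u (val x)| `^ p.
Proof.
move=> p0 OW nW [u0 eq]; rewrite energy_by_parts//; congr (_ * _).
have -> : \sum_(x : Omega) vweight (val x) * w x * `|u (val x)| `^ p =
    \sum_(x : Omega) u (val x) * (vweight (val x) * - pLaplacian p u (val x)).
  by apply: eq_bigr => x _; rewrite eq -(signed_powM _ p0); ring.
rewrite -(big_seq_fsetE _ _ predT
  (fun x => u x * (vweight x * - pLaplacian p u x))) /=.
have /fsetIidPr OWI : (Omega `<=` W)%fset by apply/fsubsetP.
rewrite (bigID (mem Omega)) /= [X in _ + X]big1 ?addr0; last first.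
  by move=> x /u0 ->; rewrite mul0r.
rewrite big_fset_condE.
have -> : [fset x in W | x \in Omega]%fset = Omega.
  by apply/fsetP => x; rewrite !inE/=; apply: andb_idl; exact: OW.
apply: eq_big_seq => x xO; congr (_ * _).
rewrite /pLaplacian mulrN mulrA divff ?gt_eqF ?vweight_gt0// mul1r.
rewrite (@fsum_fset _ _ _ _ W); last by move=> y /= /(nW _ _ xO).
rewrite -sumrN; apply: eq_bigr => y _.
rewrite -[u x - u y]opprB signed_powN mulrN; congr (- _).
have [xy|] := boolP (adj x y).
  by rewrite mem_set ?mulr1.
rewrite /adj -leNgt => xy0.
have -> : eweight x y = 0 by apply/eqP; rewrite eq_le xy0 eweight_ge0.
by rewrite !mul0r.
Qed.

Lemma sum_eweight_le (C0 : R) W a : 1 <= C0 -> locally_finite G ->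
  bounded_geometry G C0 -> \sum_(b <- W) eweight a b <= C0 ^+ 2.
Proof.
move=> C01 lf [_ hw hdeg]; rewrite (bigID (adj a))/= [X in _ + X]big1 ?addr0.
  apply: (@le_trans _ _ (\sum_(b <- W | adj a b) C0)).
    by apply: ler_sum => b /hw/andP[].
  rewrite big_fset_condE big_const_seq count_predT iter_addr_0 -mulr_natl expr2.
  rewrite ler_wpM2r//; first lra.
  apply: le_trans (hdeg a); rewrite ler_nat; apply: fsubset_leq_card.
  apply/fsubsetP => b; rewrite !inE/= in_fset_set// => /andP[_ ab].
  by rewrite mem_set.
move=> b; rewrite /adj -leNgt => ab0.
by apply/eqP; rewrite eq_le ab0 eweight_ge0.
Qed.

Lemma edge_mass_le (C0 : R) B W : 1 <= C0 -> locally_finite G ->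
  bounded_geometry G C0 -> B `<=` [set` W] ->
  \sum_(a <- W) \sum_(b <- W) eweight a b * ((a \in B) && (b \in B))%:R
    <= C0 ^+ 3 * vmeasure B.
Proof.
move=> C01 lf bg BW; rewrite /vmeasure (fsum_fset _ BW) mulr_sumr.
apply: ler_sum => a _; case: (a \in B) => /=; last first.
  by rewrite !mulr0 big1// => b _; rewrite mulr0.
apply: (@le_trans _ _ (\sum_(b <- W) eweight a b)).
  by apply: ler_sum => b _; case: (b \in B);
    rewrite ?mulr1 ?mulr0 ?eweight_ge0.
apply: (le_trans (sum_eweight_le W a C01 lf bg)).
have [/(_ a)/andP[mu0 _] _ _] := bg.
rewrite mulr1 (exprSr C0 2) -mulrA ler_peMr ?exprn_ge0 ?(le_trans ler01)//.
by rewrite -(mulfV (_ : C0 != 0)) ?ler_wpM2l//; lra.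
Qed.

End Energy.

(** * Balanced scales and the Morrey inequality *)

(** The left-hand side of the isoperimetric inequality for the part of [A] in
    the ball of radius [2 ^ k] about [z]. *)
Definition balance (R : realType) (G : wgraph R) (A : set G) (z : G) (k : nat)
    : R :=
  Num.min (vmeasure (gball z (2 ^+ k) `&` A))
          (vmeasure (gball z (2 ^+ k) `\` A)).

Section Scales.
Context {R : realType} {G : wgraph R} (D C0 C1 theta : R).
Hypotheses (C11 : 1 <= C1) (bg : bounded_geometry G C0)
  (growth : ball_growth G D C1).
Hypotheses (thC0 : theta <= C0^-1) (thC1 : theta * (1 + 2 `^ D) <= C1^-1).
Implicit Types (x y z : G) (A : set G).

Lemma balanceC A z k : balance (~` A) z k = balance A z k.
Proof. by rewrite /balance minC setDE setCK -setDE. Qed.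

Lemma pow2_ge1 k : 1 <= 2 ^+ k :> R.
Proof. by rewrite exprn_ege1// ler1n. Qed.

Lemma finite_dyadic z k : finite_set (gball z (2 ^+ k)).
Proof. exact: finite_gball C11 growth (pow2_ge1 k). Qed.

(** If the complement of [A] is negligible at scale [k], then [A] has most of
    the ball there, which is still a fixed fraction [theta] of the volume at
    scale [k + 1]: the condition on [theta] is made for this. *)
Lemma majority_next A z k :
  vmeasure (gball z (2 ^+ k) `\` A) < theta * (2 ^+ k) `^ D ->
  theta * (2 ^+ k.+1) `^ D <= vmeasure (gball z (2 ^+ k) `&` A).
Proof.
move=> small; have /andP[low _] := growth z (pow2_ge1 k).
rewrite (vmeasureID A (finite_dyadic z k)) in low.
have pos : 0 <= (2 ^+ k : R) `^ D by exact: powR_ge0.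
have := ler_wpM2r pos thC1.
rewrite exprS powRM ?exprn_ge0//.
set P := _ `^ D in low small pos *; set Q := 2 `^ D.
set m1 := vmeasure _ in low *; set m2 := vmeasure _ in low small.
lra.
Qed.

(** At scale [0] the single vertex [z] already carries the mass [theta], so the
    lack of balance can only come from a small complement.  By [majority_next]
    the same alternative persists from each scale to the next. *)
Lemma minority_small A z n : A z ->
  (forall k, (k <= n)%N -> balance A z k < theta * (2 ^+ k) `^ D) ->
  vmeasure (gball z (2 ^+ n) `\` A) < theta * (2 ^+ n) `^ D.
Proof.
move=> Az; elim: n => [|n IH] unbal; have := unbal _ (leqnn _);
  rewrite /balance gt_min => /orP[|//].
- rewrite expr0 powR1 mulr1 ltNge => /negP[].
  apply: (le_trans thC0); have [/(_ z)/andP[mz _] _ _] := bg.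
  apply: (le_trans mz); rewrite -vmeasure1; apply: vmeasureS.
    exact/finite_setIl/(finite_dyadic z 0).
  by move=> _ ->; split => //; exact: gball_center.
- rewrite ltNge => /negP[].
  apply: (le_trans (majority_next (IH _))).
    by move=> k kn; apply: unbal; exact: leqW.
  apply: vmeasureS; first exact/finite_setIl/finite_dyadic.
  apply: setSI => a /le_trans; apply; rewrite lee_fin exprS.
  by rewrite ler_peMl ?exprn_ge0// ler1n.
Qed.

(** Otherwise [minority_small] makes the complement of [A] small in the ball of
    radius [2 ^ (n + 1)] about [x], and [A] small in the ball of radius [2 ^ n]
    about [y].  The second ball lies inside the first, and the complement of
    [A] has a majority there: a contradiction. *)
Lemma balanced_scale A x y m n : A x -> ~ A y ->
  is_path_of_length x y m -> (m <= 2 ^ n)%N ->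
  exists zk : G * nat, [/\ zk.1 \in [:: x; y], (zk.2 <= n.+1)%N &
    theta * (2 ^+ zk.2) `^ D <= balance A zk.1 zk.2].
Proof.
move=> Ax nAy pxy mn; apply: contrapT => none.
have unbal z k : z \in [:: x; y] -> (k <= n.+1)%N ->
    balance A z k < theta * (2 ^+ k) `^ D.
  by move=> zxy kn; rewrite ltNge; apply/negP => h; apply: none; exists (z, k).
have : vmeasure (gball x (2 ^+ n.+1) `\` A) < theta * (2 ^+ n.+1) `^ D.
  by apply: minority_small => // k kn; apply: unbal; rewrite ?inE ?eqxx.
have : vmeasure (gball y (2 ^+ n) `\` ~` A) < theta * (2 ^+ n) `^ D.
  apply: minority_small => // k kn; rewrite balanceC.
  by apply: unbal; rewrite ?inE ?eqxx ?orbT// leqW.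
move=> /majority_next ymaj; rewrite ltNge => /negP[]; apply: (le_trans ymaj).
apply: vmeasureS.
  exact: sub_finite_set (@subDsetl _ _ _) (finite_dyadic _ _).
rewrite setDE; apply: setSI; rewrite exprS mulrDl mul1r.
by apply: gball_subset pxy _; rewrite -natrX ler_nat.
Qed.

(** The isoperimetric inequality, divided by [theta 2^(kD)]. *)
Lemma cut_at_balanced_scale (C2 : R) (W : {fset G}) A z k :
  0 < theta -> 1 <= C2 -> isoperimetric G C2 ->
  gball z (2 ^+ k) `<=` [set` W] ->
  theta * (2 ^+ k) `^ D <= balance A z k ->
  1 <= C2 / theta * (2 ^+ k) `^ (1 - D) * \sum_(a <- W) \sum_(b <- W)
    eweight a b * ((a \in gball z (2 ^+ k)) && (b \in gball z (2 ^+ k)))%:R *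
    ((a \in A) && (b \notin A))%:R.
Proof.
move=> th0 C21 iso BW bal; set B := gball z _ in BW *.
have BA : B `\` (B `&` A) = B `\` A.
  by rewrite !setDE setCI setIUr setICr set0U.
have := iso z _ (B `&` A) (pow2_ge1 k) (@subIsetl _ _ _).
rewrite -/B BA => /(le_trans bal); rewrite (@cut_weight_fset _ _ _ _ W); first last.
- by move=> a [/BW].
- by move=> a [/BW].
have -> : \sum_(a <- W) \sum_(b <- W)
    eweight a b * ((a \in B `&` A) && (b \in B `\` A))%:R =
  \sum_(a <- W) \sum_(b <- W)
    eweight a b * ((a \in B) && (b \in B))%:R *
    ((a \in A) && (b \notin A))%:R.
  apply: eq_bigr => a _; apply: eq_bigr => b _.
  rewrite -mulrA -natrM mulnb in_setI in_setD; congr (_ * _%:R).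
  by rewrite andbACA.
set S := \sum_(a <- W) _ => h.
have P0 : 0 < (2 ^+ k : R) `^ D by rewrite powR_gt0// exprn_gt0.
have -> : (2 ^+ k : R) `^ (1 - D) = 2 ^+ k / (2 ^+ k) `^ D.
  rewrite powRB ?powRr1 ?exprn_ge0//.
  by rewrite expf_eq0 pnatr_eq0 andbF implybT.
rewrite -(ler_pM2l (mulr_gt0 th0 P0)) mulr1; apply: (le_trans h).
set P := _ `^ D in P0 *; set q := 2 ^+ k.
rewrite le_eqVlt; apply/orP; left; apply/eqP.
by field; rewrite !gt_eqF.
Qed.
(** [cut_at_balanced_scale] is applied to the level set [{u >= t}] for every
    [t] between [u y] and [u x].  The balanced scale depends on [t], so all the
    balls are summed before integrating in [t]. *)
Lemma level_increment (C2 : R) (W : {fset G}) (u : G -> R) x y m n :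
  0 < theta -> 1 <= C2 -> isoperimetric G C2 ->
  is_path_of_length x y m -> (m <= 2 ^ n)%N ->
  (forall z k, z \in [:: x; y] -> (k <= n.+1)%N ->
     gball z (2 ^+ k) `<=` [set` W]) ->
  u y <= u x ->
  u x - u y <= \sum_(z <- [:: x; y]) \sum_(k < n.+2)
    C2 / theta * (2 ^+ k) `^ (1 - D) * \sum_(a <- W) \sum_(b <- W)
    eweight a b * ((a \in gball z (2 ^+ k)) && (b \in gball z (2 ^+ k)))%:R *
    `|u a - u b|.
Proof.
move=> th0 C21 iso pxy mn BW uyx; set kappa := C2 / theta.
(* a single index list for balls and edges, as [layer_cake] takes one sum *)
pose J := [seq (z, k) | z <- [:: x; y], k <- iota 0 n.+2].
pose T := [seq (a, b) | a <- enum_fset W, b <- enum_fset W].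
pose g (i : (G * nat) * (G * G)) := kappa * (2 ^+ i.1.2) `^ (1 - D) *
  (eweight i.2.1 i.2.2 * ((i.2.1 \in gball i.1.1 (2 ^+ i.1.2)) &&
    (i.2.2 \in gball i.1.1 (2 ^+ i.1.2)))%:R).
have unfoldE (h : G -> G -> R) :
    \sum_(i <- [seq (j, e) | j <- J, e <- T]) g i * h i.2.1 i.2.2 =
    \sum_(z <- [:: x; y]) \sum_(k < n.+2)
      kappa * (2 ^+ k) `^ (1 - D) * \sum_(a <- W) \sum_(b <- W)
      eweight a b * ((a \in gball z (2 ^+ k)) && (b \in gball z (2 ^+ k)))%:R *
      h a b.
  rewrite big_allpairs big_allpairs; apply: eq_bigr => z _.
  rewrite -[iota 0 n.+2]/(index_iota 0 n.+2) big_mkord; apply: eq_bigr => k _.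
  rewrite big_allpairs mulr_sumr; apply: eq_bigr => a _.
  rewrite mulr_sumr; apply: eq_bigr => b _.
  by rewrite /g /= !mulrA.
rewrite -(unfoldE (fun a b => `|u a - u b|)).
have kap0 : 0 <= kappa.
  by rewrite mulr_ge0 ?invr_ge0 ?(ltW th0)//; lra.
apply: (layer_cake (l := fun i => u i.2.2) (r := fun i => u i.2.1)) => //.
  move=> i; apply: mulr_ge0; first exact: mulr_ge0 kap0 (powR_ge0 _ _).
  exact: mulr_ge0 (eweight_ge0 _ _) (ler0n _ _).
move=> t /andP[yt tx].
rewrite (unfoldE (fun a b => ((u b < t <= u a)%R)%:R)).
have [|[z k] /= [zxy kn bal]] :=
    @balanced_scale [set a | t <= u a] x y m n tx _ pxy mn.
  by apply/negP; rewrite -ltNge.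
apply: (le_trans (cut_at_balanced_scale th0 C21 iso (BW z k zxy kn) bal)).
rewrite -/kappa.
have F0 z' (k' : nat) : 0 <= kappa * (2 ^+ k') `^ (1 - D) *
    \sum_(a <- W) \sum_(b <- W)
    eweight a b * ((a \in gball z' (2 ^+ k')) && (b \in gball z' (2 ^+ k')))%:R *
    ((u b < t <= u a)%R)%:R.
  apply: mulr_ge0; first exact: mulr_ge0 kap0 (powR_ge0 _ _).
  rewrite sumr_ge0// => a _.
  by rewrite sumr_ge0// => b _; rewrite !mulr_ge0 ?eweight_ge0.
(* all terms being nonnegative, keep that of the balanced ball *)
rewrite (big_rem _ zxy) (bigD1 (Ordinal (kn : (k < n.+2)%N)))//=.
rewrite -addrA ler_wpDr//.
  by rewrite addr_ge0 ?sumr_ge0// => *; rewrite sumr_ge0.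
rewrite le_eqVlt; apply/orP; left; apply/eqP; congr (_ * _).
apply: eq_bigr => a _; apply: eq_bigr => b _; congr (_ * _%:R).
have memA d : (d \in [set a | t <= u a]) = (t <= u d).
  by apply/idP/idP; rewrite inE.
by rewrite !memA -ltNge andbC.
Qed.
End Scales.

Lemma balance_const_exists (R : realType) (D C0 C1 : R) : 1 <= C0 -> 1 <= C1 ->
  exists theta : R,
    [/\ 0 < theta, theta <= C0^-1 & theta * (1 + 2 `^ D) <= C1^-1].
Proof.
move=> C01 C11; have Q0 : 0 <= (2 : R) `^ D by exact: powR_ge0.
have X : 1 <= C1 * (1 + 2 `^ D) by rewrite mulr_ege1// lerDl.
have X0 : 0 < C0 * (C1 * (1 + 2 `^ D)) by rewrite mulr_gt0; lra.
exists (C0 * (C1 * (1 + 2 `^ D)))^-1; split.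
- by rewrite invr_gt0.
- by rewrite lef_pV2 ?posrE ?ler_peMr//; lra.
- rewrite mulrA invfM mulfVK; last by lra.
  by rewrite lef_pV2 ?posrE ?mulr_gt0 ?ler_peMl//; lra.
Qed.

(** By homogeneity the increment may be normalised to [1].  In
    [level_increment] each edge term is bounded by [le_level_add_powR] with the
    level of its scale: the level itself is multiplied by the total edge weight
    of the ball, at most [C3 2^(kD)], and the p-th powers by the energy. *)
Lemma morrey (R : realType) (p D C0 C1 C2 : R) :
  1 < D -> D < p -> 1 <= C0 -> 1 <= C1 -> 1 <= C2 ->
  exists K : R, 0 < K /\
  forall (G : wgraph R) (W : {fset G}) (u : G -> R) x y m n,
  locally_finite G ->
  bounded_geometry G C0 -> ball_growth G D C1 -> isoperimetric G C2 ->
  is_path_of_length x y m -> (m <= 2 ^ n)%N ->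
  (forall z k, z \in [:: x; y] -> (k <= n.+1)%N ->
     gball z (2 ^+ k) `<=` [set` W]) ->
  `|u x - u y| `^ p <= K * (2 ^+ n.+1) `^ (p - D) * energy p W u.
Proof.
move=> D1 Dp C01 C11 C21.
have [theta [th0 thC0 thC1]] := balance_const_exists D C01 C11.
pose kappa := C2 / theta.
have kap0 : 0 < kappa by rewrite mulr_gt0 ?invr_gt0//; lra.
pose C3 := C0 ^+ 3 * C1.
have C30 : 0 < C3 by rewrite mulr_gt0 ?exprn_gt0//; lra.
have kapE : C2 / theta = kappa by [].
have C3E : C0 ^+ 3 * C1 = C3 by [].
clearbody kappa C3.
(* the factor 2 accounts for the balls about both [x] and [y] *)
have [|K [K0 HK]] := @dyadic_levels R p D (2 * kappa * C3) D1 Dp.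
  by rewrite !mulr_gt0.
exists (4 * kappa * K); split; first by rewrite !mulr_gt0.
move=> G W u x y m n lf bg growth iso pxy mn BW.
have [uxy|uxy] := eqVneq (u x - u y) 0.
  rewrite uxy normr0 powR0; last by lra.
  by rewrite !mulr_ge0 ?powR_ge0 ?energy_ge0 ?(ltW K0) ?(ltW kap0).
pose c := (u x - u y)^-1; pose v a := c * u a.
have v1 : v x - v y = 1 by rewrite -mulrBr mulVf.
have [l [l0 small large]] := HK n.+1.
have E0 : 0 <= energy p W v by exact: energy_ge0.
have inc : v y <= v x by lra.
have := level_increment C11 bg growth thC0 thC1 th0 C21 iso pxy mn BW inc.
rewrite v1 kapE.
set S := \sum_(z <- _) _ => one.
have bound z (k : 'I_n.+2) : z \in [:: x; y] ->
  kappa * (2 ^+ k) `^ (1 - D) * (\sum_(a <- W) \sum_(b <- W)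
    eweight a b * ((a \in gball z (2 ^+ k)) && (b \in gball z (2 ^+ k)))%:R *
    `|v a - v b|) <=
  kappa * C3 * (2 ^+ k * l k) +
  kappa * energy p W v * ((2 ^+ k) `^ (1 - D) * l k `^ (1 - p)).
  move=> zxy; have BWk := BW z k zxy (ltn_ord k).
  have q0 : 0 < (2 ^+ k : R) `^ (1 - D) by rewrite powR_gt0// exprn_gt0.
  have qq : (2 ^+ k : R) `^ (1 - D) * (2 ^+ k) `^ D = 2 ^+ k.
    rewrite -powRD ?subrK ?powRr1 ?exprn_ge0//.
    by rewrite expf_eq0 pnatr_eq0 andbF implybT.
  have -> : kappa * C3 * (2 ^+ k * l k) +
      kappa * energy p W v * ((2 ^+ k) `^ (1 - D) * l k `^ (1 - p)) =
    kappa * (2 ^+ k) `^ (1 - D) *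
      (l k * (C3 * (2 ^+ k) `^ D) + l k `^ (1 - p) * energy p W v).
    by move: qq; set q := _ `^ (1 - D); set V := _ `^ D => <-; ring.
  rewrite ler_pM2l ?mulr_gt0//.
  have mass := edge_mass_le C01 lf bg BWk.
  have /andP[_ vol] := growth z _ (pow2_ge1 k).
  have mass' := le_trans mass (ler_wpM2l (exprn_ge0 3 (le_trans ler01 C01)) vol).
  rewrite mulrA C3E in mass'.
  apply: le_trans (lerD (ler_wpM2l (ltW (l0 k)) mass') (lexx _)).
  rewrite !mulr_sumr -big_split/=; apply: ler_sum => a _.
  rewrite !mulr_sumr -big_split/=; apply: ler_sum => b _.
  case: (_ && _); rewrite ?mulr1 ?mulr0 ?mul0r ?add0r; last first.
    by rewrite !mulr_ge0 ?powR_ge0 ?eweight_ge0.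
  rewrite [leRHS](_ : _ = eweight a b *
    (l k + l k `^ (1 - p) * `|v a - v b| `^ p)); last by ring.
  rewrite ler_wpM2l ?eweight_ge0//.
  by apply: le_level_add_powR => //; lra.
have {bound} : S <= \sum_(z <- [:: x; y])
    (kappa * C3 * \sum_(k < n.+2) 2 ^+ k * l k +
     kappa * energy p W v *
       \sum_(k < n.+2) (2 ^+ k) `^ (1 - D) * l k `^ (1 - p)).
  rewrite /S big_seq [leRHS]big_seq; apply: ler_sum => z zxy.
  rewrite [X in _ <= X + _]mulr_sumr [X in _ <= _ + X]mulr_sumr -big_split/=.
  by apply: ler_sum => k _; exact: bound.
move=> /(le_trans one); rewrite !big_cons big_nil addr0.
have large' := ler_wpM2l (mulr_ge0 (ltW kap0) E0) large.
move: small large'; set S1 := \sum_(k < _) _; set S2 := \sum_(k < _) _.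
set P := (2 ^+ n.+1) `^ (p - D) => small large' one'.
have key : 1 <= 4 * kappa * K * P * energy p W v.
  have -> : 4 * kappa * K * P * energy p W v =
    4 * (kappa * energy p W v * (K * P)) by ring.
  lra.
have d0 : 0 < `|u x - u y| `^ p by rewrite powR_gt0// normr_gt0.
move: key; rewrite energy_scale /c normfV -powR_inv1// -powRrM mulN1r powRN.
by rewrite mulrCA ler_pdivlMl// mulr1.
Qed.

(** * The lower bound for the weight *)

Lemma exists_notin_fset (R : realType) (G : wgraph R) (Omega : {fset G}) :
  exists y : G, y \notin Omega.
Proof.
apply: contrapT => none; apply: infinite_nat.
rewrite -(eq_finite_set (vertex_countably_infinite G)).
apply: sub_finite_set (finite_fset Omega) => y _ /=.
by apply: contrapT => /negP yO; apply: none; exists y.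
Qed.

(** Distances are infima of lengths, that is of natural numbers, hence attained
    by a shortest path out of the domain; the supremum over the domain is finite
    because the domain is. *)
Lemma exit_path (R : realType) (G : wgraph R) (Omega : {fset G}) (x : G) :
  connected_graph G -> x \in Omega ->
  exists y m, [/\ y \notin Omega, is_path_of_length x y m, (0 < m)%N &
    m%:R <= fine (inner_radius [set` Omega])].
Proof.
move=> conn xO.
pose P z m := exists y : G, y \notin Omega /\ is_path_of_length z y m.
have exP z : exists m, `[< P z m >].
  have [y yO] := exists_notin_fset Omega; have [m zy] := conn z y.
  by exists m; apply/asboolP; exists y.
pose d z := ex_minn (exP z).
have Pd z : P z (d z) by rewrite /d; case: ex_minnP => m /asboolP.
have dmin z m : P z m -> (d z <= m)%N.
  by rewrite /d; case: ex_minnP => k _ kmin /asboolP; exact: kmin.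
have dE z : gdist_set z (~` [set` Omega]) = (d z)%:R%:E.
  apply/eqP; rewrite eq_le; apply/andP; split.
    have [y [yO zy]] := Pd z.
    apply: (@le_trans _ _ (gdist z y)).
      by apply: ereal_inf_lbound; exists y => //; exact/negP.
    by apply: ereal_inf_lbound; exists (d z).
  apply: le_ereal_inf_tmp => _ [y /negP yO <-].
  apply: le_ereal_inf_tmp => _ [m zy <-].
  by rewrite lee_fin ler_nat; apply: dmin; exists y.
have low : ((d x)%:R%:E <= inner_radius [set` Omega])%E.
  by rewrite -dE; apply: ereal_sup_ubound; exists x.
have up : (inner_radius [set` Omega] <=
    (\max_(z <- Omega) d z)%N%:R%:E)%E.
  apply: ge_ereal_sup => _ [z zO <-]; rewrite dE lee_fin ler_nat.
  exact: leq_bigmax_seq.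
have fin : inner_radius [set` Omega] \is a fin_num.
  apply: fin_real; rewrite (lt_le_trans (ltNyr _) low).
  exact: le_lt_trans up (ltry _).
have [y [yO xy]] := Pd x; exists y, (d x); split=> //.
  rewrite lt0n; apply/eqP => d0; move: xy; rewrite d0 => -[s [_ xy /size0nil s0]].
  by move: xy yO; rewrite s0 /= => <-; rewrite xO.
by rewrite -lee_fin fineK.
Qed.

Lemma potential_energy_le_l1norm (R : realType) (G : wgraph R) (p M : R)
    (Omega : {fset G}) (w : Omega -> R) (u : G -> R) :
  0 <= p -> 0 <= M -> (forall x : Omega, `|u (val x)| <= M) ->
  \sum_(x : Omega) vweight (val x) * w x * `|u (val x)| `^ p
    <= M `^ p * l1norm w^\+.
Proof.
move=> p0 M0 uM; rewrite /l1norm mulr_sumr; apply: ler_sum => x _.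
rewrite -mulrA [leRHS]mulrCA ler_wpM2l ?(ltW (vweight_gt0 _))//.
apply: (@le_trans _ _ (`|w^\+ x| * `|u (val x)| `^ p)).
  rewrite ler_wpM2r ?powR_ge0//; apply: le_trans (ler_norm _).
  by rewrite /funrpos le_max lexx.
rewrite mulrC ler_wpM2r//.
by rewrite ge0_ler_powR ?nnegrE.
Qed.

Theorem theorem3p7 (R : realType) (p D C0 C1 C2 : R)
    (hD : 1 < D) (hC0 : 1 <= C0) (hC1 : 1 <= C1) (hC2 : 1 <= C2)
    (hp : D < p) :
  exists c : R, 0 < c /\
    forall G : wgraph R,
      connected_graph G -> locally_finite G ->
      bounded_geometry G C0 -> ball_growth G D C1 -> isoperimetric G C2 ->
    forall (Omega : {fset G}) (w : Omega -> R),
      Omega != fset0 ->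
      (exists u : G -> R,
          dirichlet_solution p w u /\ exists x : G, u x != 0) ->
      c * fine (inner_radius [set` Omega]) `^ (- (p - D)) <= l1norm w^\+.
Proof.
have [K [K0 HK]] := morrey hD hp hC0 hC1 hC2.
exists (2 * K * 4 `^ (p - D))^-1; split.
  by rewrite invr_gt0 !mulr_gt0 ?powR_gt0.
move=> G conn lf bg growth iso Omega w _ [u [sol [x0 ux0]]].
have x0O : x0 \in Omega by apply: contraNT ux0 => /(proj1 sol) ->.
have [xs xsmax] : exists xs : Omega, forall x : Omega,
    `|u (val x)| <= `|u (val xs)|.
  exists [arg max_(i > [` x0O]%fset) `|u (val i)|]%O.
  by case: arg_maxP => //= i _ imax x; exact: imax.
have M0 : 0 < `|u (val xs)|.
  by apply: lt_le_trans (xsmax [` x0O]%fset); rewrite normr_gt0.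
have [y [m [yO xy m0 mr]]] := exit_path conn (valP xs).
set r := fine _ in mr *.
have r0 : 0 < r by apply: lt_le_trans mr; rewrite ltr0n.
(* the least power of two above the distance, which loses at most a factor 2 *)
pose n := (trunc_log 2 m).+1.
have /andP[lo /ltnW mn] := trunc_log_bounds (isT : (1 < 2)%N) m0.
have nr : 2 ^+ n.+1 <= 4 * r.
  have : 2 ^+ trunc_log 2 m <= r by apply: le_trans mr; rewrite -natrX ler_nat.
  by rewrite /n !exprS; lra.
have fgball (z : G) : finite_set (gball z (2 ^+ n.+1)).
  exact: finite_dyadic hC1 growth _ _.
pose S := [set` Omega] `|` \bigcup_(x in [set` Omega]) neighbours x `|`
  (gball (val xs) (2 ^+ n.+1) `|` gball y (2 ^+ n.+1)).
have finS : finite_set S.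
  rewrite !finite_setU; split; last by split; exact: fgball.
  split; first exact: finite_fset.
  by apply: bigcup_finite; [exact: finite_fset|move=> z _; exact: lf].
have SW : S `<=` [set` fset_set S] by rewrite fset_setK.
have OS : forall x, x \in Omega -> x \in fset_set S.
  by move=> x xO; apply: SW; left; left.
have NS : forall x z, x \in Omega -> adj x z -> z \in fset_set S.
  by move=> x z xO xz; apply: SW; left; right; exists x.
have BS : forall z k, z \in [:: val xs; y] -> (k <= n.+1)%N ->
    gball z (2 ^+ k) `<=` [set` fset_set S].
  move=> z k zxy kn a za; apply: SW; right.
  have zan : gball z (2 ^+ n.+1) a.
    apply: (le_trans za); rewrite lee_fin.
    by apply: ler_weXn2l => //; rewrite ler1n.
  by move: zxy zan; rewrite !inE => /orP[]/eqP <-; [left|right].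
have := HK G (fset_set S) u (val xs) y m n lf bg growth iso xy mn BS.
have p0 : 0 < p by lra.
rewrite (proj1 sol y yO) subr0 (energy_solution p0 OS NS sol) => main.
have en := potential_energy_le_l1norm w (ltW p0) (ltW M0) xsmax.
have L0 : 0 <= l1norm w^\+.
  by rewrite sumr_ge0// => x _; rewrite mulr_ge0// ltW// vweight_gt0.
have pw : (2 ^+ n.+1) `^ (p - D) <= 4 `^ (p - D) * r `^ (p - D).
  rewrite -powRM ?(ltW r0)//; apply: ge0_ler_powR => //.
  - lra.
  - by rewrite nnegrE exprn_ge0.
  - by rewrite nnegrE mulr_ge0 ?(ltW r0).
have Mp : 0 < `|u (val xs)| `^ p by rewrite powR_gt0.
have X0 : 0 < r `^ (p - D) by rewrite powR_gt0.
have Q0 : 0 < (4 : R) `^ (p - D) by rewrite powR_gt0.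
rewrite powRN -invfM -[leLHS]mulr1 ler_pdivrMl; last first.
  by rewrite mulr_gt0 ?mulr_gt0.
rewrite -(ler_pM2l Mp) mulr1; apply: (le_trans main).
set T := 4 `^ _ in Q0 pw *; set X := r `^ _ in X0 pw *.
set P := _ `^ _ in pw *; set E := \sum_(x : Omega) _ in en *.
rewrite (_ : _ * _ = 2 * K * P * E); last by ring.
have PE : P * E <= T * X * (`|u (val xs)| `^ p * l1norm w^\+).
  apply: (le_trans (ler_wpM2l (powR_ge0 _ _) en)).
  by rewrite ler_wpM2r// mulr_ge0// ltW.
rewrite -mulrA [leRHS](_ : _ =
  2 * K * (T * X * (`|u (val xs)| `^ p * l1norm w^\+))); last by ring.
by rewrite ler_pM2l ?mulr_gt0.
Qed.
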